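(* Let $n\ge 1$ and let $y_1,\dots,y_n$ be nonzero real numbers such that $|y_i|<|y_{i+1}|$ for $i=1,\dots,n-1$. Let $p$ be the number of indices $i$ with $y_i>0$ and let $m=n-p$ be the number of indices $i$ with $y_i<0$. Then $$P_n(y_1,\dots,y_n):=\prod_{1\le i<j\le n}\Big(1-\frac{y_i}{y_j}\Big)\le 2^{\min\{p,m\}}.$$ *)

(* Defs.v *)
From mathcomp Require Import all_boot all_order all_algebra.
From mathcomp Require Import reals.

Set Implicit Arguments.
Unset Strict Implicit.
Unset Printing Implicit Defensive.

Import Order.TTheory GRing.Theory Num.Theory.
Local Open Scope ring_scope.

(* y_1, ..., y_n is encoded as y : 'I_n -> R, so indices start at 0. *)
Definition Pn (R : realType) (n : nat) (y : 'I_n -> R) : R :=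
  \prod_(i < n) \prod_(j < n | (i < j)%N) (1 - y i / y j).

Definition npos (R : realType) (n : nat) (y : 'I_n -> R) : nat :=
  #|[set i : 'I_n | 0 < y i]|.

Definition nneg (R : realType) (n : nat) (y : 'I_n -> R) : nat :=
  #|[set i : 'I_n | y i < 0]|.

(* Main.v *)
Require Import Defs.
From mathcomp Require Import all_boot all_order all_algebra.
From mathcomp Require Import reals.
From mathcomp Require Import ring lra.

Set Implicit Arguments.
Unset Strict Implicit.
Unset Printing Implicit Defensive.

Import Order.TTheory GRing.Theory Num.Theory.
Local Open Scope ring_scope.

(** Split the sequence, read by increasing absolute value, into subsequences
    ("chains") of alternating signs: each new entry is appended to the most
    recently modified chain whose last entry has the opposite sign, and opens
    a new chain if there is none.  A factor [1 - y_i / y_j] exceeds [1] only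
    when the signs of [y_i] and [y_j] differ.  Between two chains, each such
    factor can be grouped with others so that the cross product is at most
    [1], thanks to
    [(1 - a) (1 + a b) <= 1] and
    [(1 - a) (1 + a b) (1 + a t) (1 - a b t) <= 1] for [a, b, t] in [[0, 1]].
    Inside a chain the same inequalities leave, for each negative entry, only
    the three factors among it and its two neighbours, which contribute at
    most [2] by [(1 + a) (1 + t) (1 - a t) <= 2].  So the product is at most [2^m],
    and at most [2^p] by the symmetry [y -> - y]. *)

Lemma seq_ind2step (T : Type) (P : seq T -> Prop) :
  P [::] -> (forall x, P [:: x]) -> (forall x z s, P s -> P [:: x, z & s]) ->
  forall s, P s.
Proof.
move=> P0 P1 P2 s; suff [] : P s /\ forall x, P (x :: s) by [].
by elim: s => [|z s [Ps Pzs]]; split=> // x; apply: P2.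
Qed.

(** * Products over pairs, rows and blocks of entries *)

Section PairProducts.
Variable R : realFieldType.
Implicit Types (x y z : R) (s t U V X Z : seq R) (cs : seq (seq R)).

(** Comparing absolute values makes the factor symmetric, ties included. Hence [pair_prod] depends
    only on the multiset of entries, which may be regrouped into chains. *)
Definition pair_factor x y : R := if `|x| < `|y| then 1 - x / y else 1 - y / x.

Definition row_prod y s : R := \prod_(z <- s) pair_factor z y.

Definition cross_prod U V : R := \prod_(u <- U) row_prod u V.

Fixpoint pair_prod s : R :=
  if s is y :: t then row_prod y t * pair_prod t else 1.

Lemma pair_factorC : commutative pair_factor.
Proof.
move=> x y; rewrite /pair_factor; case: (ltgtP `|x| `|y|) => // /eqP.
by rewrite eqr_norm2 => /orP[] /eqP ->; rewrite // invrN mulrN mulNr.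
Qed.

Lemma pair_factorE x y : `|x| < `|y| -> pair_factor x y = 1 - x / y.
Proof. by rewrite /pair_factor => ->. Qed.

Lemma pair_factor_ge0 x y : 0 <= pair_factor x y.
Proof.
have le1 (a b : R) : `|a| <= `|b| -> 0 <= 1 - a / b.
  move=> ab; rewrite subr_ge0 (le_trans (ler_norm _)) // normrM normfV.
  have [->|b0] := eqVneq b 0; first by rewrite normr0 invr0 mulr0.
  by rewrite ler_pdivrMr ?normr_gt0 // mul1r.
by rewrite /pair_factor; case: ltP => [/ltW|]; apply: le1.
Qed.

Lemma row_prod_ge0 y s : 0 <= row_prod y s.
Proof. by apply: prodr_ge0 => z _; apply: pair_factor_ge0. Qed.

Lemma cross_prod_ge0 U V : 0 <= cross_prod U V.
Proof. by apply: prodr_ge0 => z _; apply: row_prod_ge0. Qed.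

Lemma pair_prod_ge0 s : 0 <= pair_prod s.
Proof. by elim: s => //= y s IH; rewrite mulr_ge0 ?row_prod_ge0. Qed.

Lemma row_prod_cons y z s :
  row_prod y (z :: s) = pair_factor z y * row_prod y s.
Proof. exact: big_cons. Qed.

Lemma row_prod_nil y : row_prod y [::] = 1.
Proof. exact: big_nil. Qed.

Lemma row_prod_cat y s t : row_prod y (s ++ t) = row_prod y s * row_prod y t.
Proof. exact: big_cat. Qed.

Lemma cross_prod_cons y U V :
  cross_prod (y :: U) V = row_prod y V * cross_prod U V.
Proof. exact: big_cons. Qed.

Lemma cross_prodC U V : cross_prod U V = cross_prod V U.
Proof.
rewrite /cross_prod /row_prod exchange_big; apply: eq_bigr => v _.
by apply: eq_bigr => u _; rewrite pair_factorC.
Qed.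

Lemma cross_prod_catr U V Z :
  cross_prod U (V ++ Z) = cross_prod U V * cross_prod U Z.
Proof.
by rewrite /cross_prod -big_split; apply: eq_bigr => u _; rewrite row_prod_cat.
Qed.

Lemma pair_prod_cat U V :
  pair_prod (U ++ V) = pair_prod U * cross_prod U V * pair_prod V.
Proof.
elim: U => [|u U IH] /=; first by rewrite /cross_prod big_nil !mul1r.
by rewrite IH row_prod_cat cross_prod_cons; ring.
Qed.

Lemma perm_pair_prod s t : perm_eq s t -> pair_prod s = pair_prod t.
Proof.
elim: s t => [|y s IH] t; first by rewrite perm_sym => /perm_nilP ->.
move=> st; have yt : y \in t by rewrite -(perm_mem st) mem_head.
case/splitPr: yt st => t1 t2; rewrite perm_sym -cat1s perm_catCA /= perm_cons.
rewrite perm_sym => st; rewrite (IH _ st) !pair_prod_cat /=.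
have -> : row_prod y s = row_prod y (t1 ++ t2) by apply: perm_big.
rewrite row_prod_cat.
rewrite [cross_prod t1 (_ :: _)]cross_prodC cross_prod_cons (cross_prodC t2).
by ring.
Qed.

Lemma pair_prod_nth n s : size s = n ->
  pair_prod s =
  \prod_(i < n) \prod_(j < n | (i < j)%N) pair_factor s`_i s`_j.
Proof.
elim: s n => [|y s IH] [|n] //=; first by rewrite big_ord0.
move=> [sn]; rewrite big_ord_recl; congr (_ * _).
  rewrite big_mkcond big_ord_recl /= mul1r /row_prod (big_nth 0) sn big_mkord.
  by apply: eq_bigr => i _; rewrite pair_factorC.
rewrite (IH _ sn); apply: eq_bigr => i _.
rewrite big_mkcond [RHS]big_mkcond big_ord_recl /= mul1r.
by apply: eq_bigr.
Qed.

(** * Alternating chains and bounds on their rows *)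

(* Sequences are listed from the largest absolute value down. *)
Definition alt_step x z : bool := (`|z| < `|x|) && (x * z < 0).

Definition alt_chain X : bool :=
  if X is x :: s then (x != 0) && path alt_step x s else false.

(** With ratios in ]0, 1[ as parameters, every bound below becomes a polynomial inequality. *)
Lemma alt_step_ratio y z : alt_step y z ->
  exists2 a, 0 < a < 1 & z = - (a * y).
Proof.
case/andP=> zy yz.
have y0 : y != 0 by apply: contraTneq yz => ->; rewrite mul0r ltxx.
have z0 : z != 0 by apply: contraTneq yz => ->; rewrite mulr0 ltxx.
exists (- (z / y)); last by rewrite mulNr opprK divfK.
have e : - (z / y) = `|z| / `|y|.
  rewrite -normf_div ltr0_norm //.
  have -> : z / y = (y * z) * (y ^-1) ^+ 2 by field.
  by rewrite pmulr_llt0 // exprn_even_gt0 //= invr_eq0.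
by rewrite e divr_gt0 ?normr_gt0 //= ltr_pdivrMr ?normr_gt0 // mul1r.
Qed.

Lemma alt_stepW y z x : alt_step y z -> alt_step z x -> alt_step (- y) x.
Proof.
case/andP=> zy yz /andP[xz zx]; rewrite /alt_step normrN (lt_trans xz zy) /=.
have : 0 < (y * z) * (z * x) by rewrite nmulr_rgt0.
have -> : (y * z) * (z * x) = z ^+ 2 * (y * x) by ring.
have z0 : z != 0 by apply: contraTneq zx => ->; rewrite mul0r ltxx.
by rewrite pmulr_rgt0 ?exprn_even_gt0 // mulNr oppr_lt0.
Qed.

Lemma path_alt_stepW y z s :
  alt_step y z -> path alt_step z s -> path alt_step (- y) s.
Proof. by case: s => //= x s yz /andP[zx ->]; rewrite (alt_stepW yz zx). Qed.

(** Starting the path at [- y] encodes that the head of [s] has the sign of [y]. Consecutive entries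
    then contribute (1 - a) (1 + a b) <= 1, and a leftover last entry 1 - a. *)
Lemma row_prod_le1 y s : path alt_step (- y) s -> row_prod y s <= 1.
Proof.
elim/seq_ind2step: s y => [|z|z x s IH] y; first by rewrite row_prod_nil.
  rewrite /= andbT row_prod_cons row_prod_nil mulr1 => yz.
  have yz' : `|z| < `|y| by case/andP: yz; rewrite normrN.
  rewrite pair_factorE //; have [a a01 ->] := alt_step_ratio yz.
  have y0 : y != 0 by rewrite -normr_gt0 (le_lt_trans _ yz').
  have -> : - (a * - y) / y = a by field.
  lra.
move=> /= /and3P[yz zx xs].
have yz' : `|z| < `|y| by case/andP: yz; rewrite normrN.
have xy' : `|x| < `|y| by case/andP: zx => /lt_trans + _; apply.
have ys : path alt_step (- y) s.
  by apply: path_alt_stepW xs; rewrite -[y]opprK; apply: alt_stepW yz zx.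
have y0 : y != 0 by rewrite -normr_gt0 (le_lt_trans _ yz').
rewrite !row_prod_cons mulrA mulr_ile1 ?row_prod_ge0 ?IH //.
  by rewrite mulr_ge0 ?pair_factor_ge0.
rewrite !pair_factorE //.
have [a a01 za] := alt_step_ratio yz; have [b b01 xb] := alt_step_ratio zx.
have -> : z / y = a by rewrite za; field.
have -> : x / y = - (a * b) by rewrite xb za; field.
nra.
Qed.

Lemma row_prod_le2 y s : path alt_step y s -> row_prod y s <= 2.
Proof.
case: s => [|z s /= /andP[yz zs]]; first by rewrite row_prod_nil ler1n.
have yz' : `|z| < `|y| by case/andP: yz.
have y0 : y != 0 by rewrite -normr_gt0 (le_lt_trans _ yz').
rewrite row_prod_cons -[leRHS]mulr1 ler_pM ?row_prod_ge0 ?pair_factor_ge0 //.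
  rewrite pair_factorE //; have [a a01 ->] := alt_step_ratio yz.
  have -> : - (a * y) / y = - a by field.
  lra.
exact/row_prod_le1/(path_alt_stepW yz).
Qed.

(** The head of [s] has the sign of [x], opposite to [y], so the row of [y] alone may exceed 1; the
    row of [x] compensates, two entries of [s] at a time. *)
Lemma row_prod2_le1 y x s : alt_step y x -> path alt_step (- x) s ->
  row_prod x s * row_prod y s <= 1.
Proof.
move=> yx; have yx' : `|x| < `|y| by case/andP: yx.
have y0 : y != 0 by rewrite -normr_gt0 (le_lt_trans _ yx').
have [t t01 xt] := alt_step_ratio yx.
have t0 : t != 0 by lra.
elim/seq_ind2step: s => [_|z|z w s IH /=]; first by rewrite !row_prod_nil mulr1.
  rewrite /= andbT !row_prod_cons !row_prod_nil !mulr1 => xz.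
  have zx' : `|z| < `|x| by case/andP: xz; rewrite normrN.
  have [a a01 za] := alt_step_ratio xz.
  rewrite !pair_factorE ?(lt_trans zx' yx') //.
  have -> : z / x = a by rewrite za xt; field; rewrite ?t0 ?y0.
  have -> : z / y = - (a * t) by rewrite za xt; field.
  nra.
move=> /and3P[xz zw ws].
have zx' : `|z| < `|x| by case/andP: xz; rewrite normrN.
have wx' : `|w| < `|x| by case/andP: zw => /lt_trans + _; apply.
have xs : path alt_step (- x) s.
  by apply: path_alt_stepW ws; rewrite -[x]opprK; apply: alt_stepW xz zw.
rewrite !row_prod_cons.
set f1 := pair_factor _ _; set f2 := pair_factor _ _.
set f3 := pair_factor _ _; set f4 := pair_factor _ _.
have -> : f1 * (f2 * row_prod x s) * (f3 * (f4 * row_prod y s)) =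
  (f1 * f2 * f3 * f4) * (row_prod x s * row_prod y s) by ring.
rewrite mulr_ile1 ?IH // ?mulr_ge0 ?pair_factor_ge0 ?row_prod_ge0 //.
rewrite /f1 /f2 /f3 /f4.
rewrite !pair_factorE ?(lt_trans zx' yx') ?(lt_trans wx' yx') //.
have [a a01 za] := alt_step_ratio xz; have [b b01 wb] := alt_step_ratio zw.
have -> : z / x = a by rewrite za xt; field; rewrite ?t0 ?y0.
have -> : z / y = - (a * t) by rewrite za xt; field.
have -> : w / x = - (a * b) by rewrite wb za xt; field; rewrite ?t0 ?y0.
have -> : w / y = a * b * t by rewrite wb za xt; field.
(* The row of [x] gives 1 - d - q and that of [y] at most 1 + d; their product is at most 1 - d^2 -
   q (1 + d). *)
set d := a * (1 - b); set q := a * (a * b).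
have d01 : 0 <= d <= 1 by rewrite /d; nra.
have q01 : 0 <= q by rewrite /q !mulr_ge0; lra.
have A : (1 - a) * (1 - - (a * b)) = 1 - d - q by rewrite /d /q; ring.
have B : (1 - - (a * t)) * (1 - a * b * t) = 1 + d * t - q * t ^+ 2.
  by rewrite /d /q; ring.
rewrite -mulrA A B.
have A0 : 0 <= 1 - d - q by rewrite -A mulr_ge0; nra.
have B1 : 1 + d * t - q * t ^+ 2 <= 1 + d.
  have : 0 <= q * t ^+ 2 by rewrite mulr_ge0 // exprn_even_ge0.
  nra.
apply: le_trans (ler_wpM2l A0 B1) _; nra.
Qed.

(** The factor 2 comes from [y], [x] and the head of [s]. The rest of [s] starts with the sign of
    [x], so [row_prod2_le1] bounds its two rows. *)
Lemma triple_le2 y x s : alt_step y x -> path alt_step x s ->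
  row_prod y (x :: s) * row_prod x s <= 2.
Proof.
move=> yx xs; have yx' : `|x| < `|y| by case/andP: yx.
have y0 : y != 0 by rewrite -normr_gt0 (le_lt_trans _ yx').
have [t t01 xt] := alt_step_ratio yx.
have t0 : t != 0 by lra.
case: s xs => [_|z s /= /andP[xz zs]].
  rewrite row_prod_cons !row_prod_nil !mulr1 pair_factorE // xt.
  have -> : - (t * y) / y = - t by field.
  lra.
have zx' : `|z| < `|x| by case/andP: xz.
rewrite !row_prod_cons.
set f1 := pair_factor _ _; set f2 := pair_factor _ _; set f3 := pair_factor _ _.
have -> : f1 * (f2 * row_prod y s) * (f3 * row_prod x s) =
  (f1 * f2 * f3) * (row_prod x s * row_prod y s) by ring.
have tail_le1 := row_prod2_le1 yx (path_alt_stepW xz zs).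
rewrite -[leRHS]mulr1 ler_pM ?mulr_ge0 ?pair_factor_ge0 ?row_prod_ge0 //.
rewrite /f1 /f2 /f3 !pair_factorE ?(lt_trans zx' yx') //.
have [a a01 za] := alt_step_ratio xz.
have -> : x / y = - t by rewrite xt; field.
have -> : z / y = a * t by rewrite za xt; field.
have -> : z / x = - a by rewrite za xt; field; rewrite ?t0 ?y0.
(* with s = a + t, q = a t: s <= 1 + q gives (1 + s + q)(1 - q) <= 2 - 2 q^2 *)
have h : a + t <= 1 + a * t by nra.
have q01 : 0 <= a * t <= 1 by nra.
nra.
Qed.

(** * The product inside one chain *)

Definition negs s : nat := count (fun x => x < 0) s.

(** Peel off a positive entry with the negative one after it: by [triple_le2] their rows cost one
    factor 2, charged to the negative entry. *)
Lemma pair_prod_chain_pos s :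
  (if s is y :: t then (0 < y) && path alt_step y t else true) ->
  pair_prod s <= 2 ^+ negs s.
Proof.
elim/seq_ind2step: s => [_ //|y|y x s IH].
  by rewrite /= row_prod_nil mulr1 => /andP[y0 _]; rewrite exprn_ege1 ?ler1n.
case/and3P=> y0 yx xs; have x0 : x < 0.
  by case/andP: yx => _; rewrite pmulr_rlt0.
have -> : negs [:: y, x & s] = (negs s).+1 by rewrite /negs /= x0 ltNge ltW.
rewrite /= mulrA exprS ler_pM ?pair_prod_ge0 ?mulr_ge0 ?row_prod_ge0 //.
  exact: triple_le2.
apply: IH; case: s xs => // z s /andP[/andP[_ xz] zs].
by rewrite -(nmulr_rlt0 _ x0) xz.
Qed.

(** A negative leading entry pays for its own row by [row_prod_le2]; what remains starts with a
    positive entry. *)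
Lemma pair_prod_chain X : alt_chain X -> pair_prod X <= 2 ^+ negs X.
Proof.
case: X => // x s /andP[]; case: (ltgtP x 0) => // x0 _ xs; last first.
  by apply: pair_prod_chain_pos; rewrite x0.
have -> : negs (x :: s) = (negs s).+1 by rewrite /negs /= x0.
rewrite exprS ler_pM ?pair_prod_ge0 ?row_prod_ge0 ?row_prod_le2 //.
apply: pair_prod_chain_pos; case: s xs => // z s /andP[/andP[_ xz] zs].
by rewrite -(nmulr_rlt0 _ x0) xz.
Qed.

(** * Products between chains *)

(* [U] is the chain with the larger leading entry.  When the leading signs
   agree, the factors in the row of the head of [U] are kept in reserve: they
   pay for the next entry appended to [U]. *)
Definition compat U V : bool :=
  if (U, V) is (u :: _, v :: _) then
    (`|v| < `|u|) &&
    (cross_prod U V <= if 0 < u * v then row_prod u V else 1)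
  else false.

Lemma compat_cross_le1 U V :
  alt_chain V -> compat U V -> cross_prod U V <= 1.
Proof.
case: U V => [|u U] [|v V] //= /andP[_ vV] /andP[vu].
case: ifP => // uv /le_trans; apply; apply: row_prod_le1.
by rewrite /= vV andbT /alt_step normrN vu mulNr oppr_lt0.
Qed.

Lemma pair_prod_flatten cs : all alt_chain cs -> pairwise compat cs ->
  pair_prod (flatten cs) <= 2 ^+ negs (flatten cs).
Proof.
elim: cs => [|X cs IH] //= /andP[cX ccs] /andP[Xcs pcs].
rewrite pair_prod_cat /negs count_cat exprD.
rewrite ler_pM ?mulr_ge0 ?pair_prod_ge0 ?cross_prod_ge0 ?IH //.
rewrite -[leRHS]mulr1 ler_pM ?pair_prod_ge0 ?cross_prod_ge0 ?pair_prod_chain //.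
elim: cs ccs Xcs {IH pcs} => [|Z cs IH] /=.
  by rewrite /cross_prod big1 // => u _; rewrite row_prod_nil.
move=> /andP[cZ ccs] /andP[XZ Xcs].
rewrite cross_prod_catr mulr_ile1 ?cross_prod_ge0 ?IH //.
exact: compat_cross_le1.
Qed.

(** * Greedy construction of the chains *)

Lemma mulr_neq0_sign x y : x != 0 -> y != 0 -> 0 < x * y \/ x * y < 0.
Proof.
move=> x0 y0; have : x * y != 0 by rewrite mulf_neq0.
by rewrite neq_lt => /orP[] ->; [right | left].
Qed.

Lemma mulr_opp_sign y x z : y * x < 0 -> (0 < y * z) = (x * z < 0).
Proof.
case: (ltgtP x 0) => [x0|x0|->]; last by rewrite mulr0 ltxx.
  by rewrite nmulr_llt0 // nmulr_rlt0 // => y0; rewrite pmulr_rgt0.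
by rewrite pmulr_llt0 // pmulr_rlt0 // => y0; rewrite nmulr_rgt0.
Qed.

(** The list [cs] runs from the most recently modified chain to the oldest. The entry [y] becomes
    the head of the first chain whose head has the opposite sign, and that chain moves to the
    front. *)
Lemma extend_chains y cs : y != 0 ->
  all (fun x => `|x| < `|y|) (flatten cs) ->
  all alt_chain cs -> pairwise compat cs ->
  exists cs', [/\ perm_eq (flatten cs') (y :: flatten cs),
    all alt_chain cs' & pairwise compat cs'].
Proof.
move=> y0 ltcs ccs pcs.
have lthead Z : Z \in cs -> `|head 0 Z| < `|y|.
  case: Z => [|z s] Zcs; first by rewrite normr0 normr_gt0.
  apply: (allP ltcs); apply/flattenP; exists (z :: s) => //; exact: mem_head.
have [hX|/hasPn noX] := boolP (has (fun Z => y * head 0 Z < 0) cs); last first.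
  (* All heads share the sign of [y]: a new chain opens, and its cross products equal the allowed
     reserve. *)
  exists ([:: y] :: cs); split=> //=; first by rewrite y0.
  rewrite pcs andbT; apply/allP => -[|z s] Zcs; first by have := allP ccs _ Zcs.
  have /andP[z0 zs] := allP ccs _ Zcs; have zy := lthead _ Zcs.
  rewrite /compat zy.
  case: (mulr_neq0_sign y0 z0) (noX _ Zcs) => /= [yz _|-> //].
  by rewrite yz cross_prod_cons /cross_prod big_nil mulr1.
case/split_find: hX lthead ccs pcs ltcs => X pre post yX noX lthead.
rewrite cat_rcons.
rewrite all_cat /= => /and3P[cpre cX cpost].
rewrite pairwise_cat /= allrel_consr.
case/and3P=> /andP[preX prepost] ppre /andP[Xpost ppost] ltcs.
have X_in : X \in rcons pre X ++ post by rewrite mem_cat mem_rcons mem_head.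
case: X => [|x s] in yX cX preX Xpost X_in ltcs lthead *.
  by rewrite /= mulr0 ltxx in yX.
have xy := lthead _ X_in; rewrite /= in xy yX.
case/andP: cX => x0 xs.
have yx : alt_step y x by rewrite /alt_step xy yX.
exists ((y :: x :: s) :: pre ++ post); split.
- by rewrite /= perm_cons !flatten_cat /= -!cat_cons perm_catCA.
- by rewrite /= y0 yx xs all_cat cpre.
rewrite /= pairwise_cat prepost ppre ppost !andbT all_cat; apply/andP; split.
  apply/allP => -[|z t] Zpre; first by have := allP cpre _ Zpre.
  have /andP[z0 zt] := allP cpre _ Zpre.
  have zy : `|z| < `|y|.
    by apply: (lthead (z :: t)); rewrite mem_cat mem_rcons inE Zpre orbT.
  (* Chains before [X] were passed over, so their heads have the sign of [y], opposite to [x]. Their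
     cross product with [X] is at most 1, and the row of [y] becomes the reserve. *)
  have yz : 0 < y * z.
    have := noX; rewrite -all_predC => /allP/(_ _ Zpre) /=.
    by case: (mulr_neq0_sign y0 z0) => // ->.
  have /andP[_] := allP preX _ Zpre.
  have -> : 0 < z * x = false.
    by rewrite mulrC ltNge ltW // -(mulr_opp_sign _ yX).
  rewrite /compat zy yz /= [cross_prod (_ :: _) (_ :: _)]cross_prodC => le1.
  by rewrite cross_prod_cons -[leRHS]mulr1 ler_wpM2l ?row_prod_ge0.
apply/allP => -[|z t] Zpost; first by have := allP cpost _ Zpost.
have /andP[z0 zt] := allP cpost _ Zpost.
have zy : `|z| < `|y| by apply: (lthead (z :: t)); rewrite mem_cat Zpost orbT.
have /andP[zx] := allP Xpost _ Zpost.
rewrite /compat zy /= [cross_prod [:: y, x & s] _]cross_prod_cons.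
rewrite (mulr_opp_sign _ yX).
(* If [z] has the sign of [x], the reserve [row_prod x (z :: t)] is spent on the row of [y];
   otherwise [z] has the sign of [y] and the row of [y] is the new reserve. *)
case: (mulr_neq0_sign x0 z0) => xz.
  rewrite xz (lt_gtF xz) => le.
  have xzt : path alt_step (- x) (z :: t).
    by apply/andP; split=> //; rewrite /alt_step normrN zx mulNr oppr_lt0.
  apply: le_trans (row_prod2_le1 yx xzt).
  by rewrite [leRHS]mulrC ler_wpM2l ?row_prod_ge0.
rewrite xz (lt_gtF xz) => le1.
by rewrite -[leRHS]mulr1 ler_wpM2l ?row_prod_ge0.
Qed.

(** As [s] decreases in absolute value, induction on it inserts the smallest entries first, so each
    new [y] dominates all chains built so far. *)
Lemma exists_chains s : all (fun x => x != 0) s ->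
  sorted (fun x z => `|z| < `|x|) s ->
  exists cs, [/\ perm_eq (flatten cs) s, all alt_chain cs & pairwise compat cs].
Proof.
elim: s => [|y s IH] /=; first by exists [::].
move=> /andP[y0 s0] ys; have [cs [ps ccs pcs]] := IH s0 (path_sorted ys).
have tr : transitive (fun x z : R => `|z| < `|x|).
  by move=> b a c ba cb; apply: lt_trans cb ba.
have lty : all (fun x => `|x| < `|y|) (flatten cs).
  by rewrite (perm_all _ ps); apply: order_path_min ys.
have [cs' [ps' ccs' pcs']] := extend_chains y0 lty ccs pcs.
by exists cs'; split=> //; rewrite (permPl ps') perm_cons.
Qed.

Lemma pair_prod_le s : all (fun x => x != 0) s ->
  sorted (fun x z => `|z| < `|x|) s -> pair_prod s <= 2 ^+ negs s.
Proof.
move=> s0 ss; have [cs [ps ccs pcs]] := exists_chains s0 ss.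
rewrite -(perm_pair_prod ps) /negs -(permP ps).
exact: pair_prod_flatten.
Qed.

End PairProducts.

(** * Transfer to indexed families *)

Lemma Pn_le_nneg (R : realType) (n : nat) (y : 'I_n -> R)
  (y_neq0 : forall i : 'I_n, y i != 0)
  (y_incr : forall i j : 'I_n, nat_of_ord j = (nat_of_ord i).+1 ->
     `|y i| < `|y j|) :
  Pn y <= 2 ^+ nneg y.
Proof.
pose s := [seq y i | i <- enum 'I_n].
have sz : size s = n by rewrite size_map size_enum_ord.
have s_nth (i : 'I_n) : s`_i = y i.
  by rewrite (nth_map i) ?size_enum_ord // nth_ord_enum.
have s_sorted : sorted (fun x z => `|x| < `|z|) s.
  apply/(sortedP 0) => i; rewrite sz => lt_i.
  have := y_incr (Ordinal (ltnW lt_i)) (Ordinal lt_i) erefl.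
  by rewrite -!s_nth.
have tr : transitive (fun x z : R => `|x| < `|z|).
  by move=> b a c; apply: lt_trans.
have -> : Pn y = pair_prod s.
  rewrite (pair_prod_nth sz); apply: eq_bigr => i _; apply: eq_bigr => j ij.
  rewrite -!s_nth pair_factorE //.
  by apply: (sorted_ltn_nth tr 0 s_sorted); rewrite // inE sz.
(* Chains need decreasing absolute values, hence the reversal; [pair_prod] is unaffected by it. *)
have -> : nneg y = negs (rev s).
  rewrite /nneg /negs count_rev count_map enumT cardE size_filter.
  by apply: eq_count => i; rewrite !inE.
rewrite -(perm_pair_prod (s := rev s)) ?perm_rev //.
apply: pair_prod_le; last by rewrite rev_sorted.
by rewrite all_rev; apply/allP => _ /mapP[i _ ->].
Qed.

Theorem mainTheorem1 (R : realType) (n : nat) (y : 'I_n -> R)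
  (hn : (1 <= n)%N)
  (y_neq0 : forall i : 'I_n, y i != 0)
  (y_incr : forall i j : 'I_n, nat_of_ord j = (nat_of_ord i).+1 ->
     `|y i| < `|y j|) :
  Pn y <= 2 ^+ minn (npos y) (nneg y).
Proof.
rewrite /minn; case: ifP => _; last exact: Pn_le_nneg.
have -> : Pn y = Pn (fun i => - y i).
  apply: eq_bigr => i _; apply: eq_bigr => j _.
  by rewrite invrN mulrNN.
have -> : npos y = nneg (fun i => - y i).
  by apply: eq_card => i; rewrite !inE oppr_lt0.
apply: Pn_le_nneg => [i|i j ij]; first by rewrite oppr_eq0.
by rewrite !normrN; apply: y_incr.
Qed.
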